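(* For any $\theta\ge0$, the function $x\mapsto J(x,\theta)$ is convex on $[2,+\infty)$. Consequently, if $\mu$ is a symmetric probability measure on $\mathbb R$ with unit variance such that, with $L(x)=\log\int e^{xt}\,d\mu(t)$ and $\psi(x)=L(x)/x^2$, one has $A:=2\sup_{x\in\mathbb R}\psi(x)\in(1,+\infty)$, the limit $B:=2\lim_{|x|\to+\infty}\psi(x)\ge0$ exists, and $x\mapsto L(\sqrt x)$ is Lipschitz on $[0,+\infty)$, then the function $\bar I(x)=\sup_{\theta\ge0}\{J(x,\theta)-\overline F(\theta)\}$, $x\ge2$, is convex.
   Context: Function $J$: let $\sigma(dx)=\frac1{2\pi}\sqrt{4-x^2}\,\mathbf 1_{|x|\le2}dx$ and $G_\sigma(x)=\frac12(x-\sqrt{x^2-4})$. For $x\ge2$ and $\theta\ge0$, $$J(x,\theta)=\theta v-\frac12\int\log(1+2\theta v-2\theta y)\,d\sigma(y),$$ where $v=2\theta$ if $0\le2\theta\le G_\sigma(x)$ and $v=x-\frac1{2\theta}$ if $2\theta>G_\sigma(x)$. Annealed spherical integral: $X_N$ is the $N\times N$ real symmetric random matrix with independent entries $(X_{ij})_{i\le j}$ such that $\sqrt N X_{ij}$ has law $\mu$ for $i<j$ and $\sqrt{N/2}\,X_{ii}$ has law $\mu$ for all $i$; for $\theta\ge0$, $F_N(\theta)=\frac1N\log\mathbb E_{X_N}\mathbb E_e[\exp(N\theta\langle e,X_Ne\rangle)]$, where $e$ is uniform on $\mathbb S^{N-1}$ and independent of $X_N$; $\overline F(\theta)=\limsup_{N\to+\infty}F_N(\theta)$.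 *)

(* Defs.v *)
From HB Require Import structures.
From mathcomp Require Import all_boot all_order all_algebra.
From mathcomp Require Import all_classical all_reals all_analysis.
From mathcomp Require Import measurable_realfun.

Set Implicit Arguments.
Unset Strict Implicit.
Unset Printing Implicit Defensive.

Import Order.TTheory GRing.Theory Num.Def Num.Theory.
Import numFieldNormedType.Exports.

Local Open Scope classical_set_scope.
Local Open Scope ring_scope.
Local Open Scope convex_scope.

Definition semicircle_pdf {R : realType} (x : R) : R :=
  (2 * pi)^-1 * Num.sqrt (4 - x ^+ 2) * \1_`[-2, 2] x.

Definition semicircle {R : realType} (V : set R) : \bar R :=
  (\int[lebesgue_measure]_(x in V) (semicircle_pdf x)%:E)%E.

Lemma semicircle_pdf_ge0 (R : realType) (x : R) : 0 <= semicircle_pdf x.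
Proof. by rewrite !mulr_ge0 ?sqrtr_ge0// invr_ge0 mulr_ge0// pi_ge0. Qed.

Lemma measurable_semicircle_pdf (R : realType) :
  measurable_fun [set: R] (@semicircle_pdf R).
Proof.
apply: measurable_funM; last exact: measurable_indic.
apply: measurable_funM => //.
have msqrt : measurable_fun [set: R] (fun x : R => Num.sqrt x).
  by apply: continuous_measurable_fun => ?; exact: sqrt_continuous.
apply: (measurableT_comp msqrt).
exact: measurable_funB.
Qed.

Section semicircle_measure.
Variable R : realType.

Let semicircle0 : semicircle (set0 : set R) = 0%E.
Proof. by rewrite /semicircle integral_set0. Qed.

Let semicircle_ge0 (A : set R) : (0 <= semicircle A)%E.
Proof. by apply: integral_ge0 => x _; rewrite lee_fin semicircle_pdf_ge0. Qed.

Let semicircle_sigma_additive : semi_sigma_additive (@semicircle R).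
Proof.
move=> A mA tA mUA; rewrite /semicircle/= ge0_integral_bigcup//=.
- apply: is_cvg_ereal_nneg_natsum_cond => n _ _; exact: semicircle_ge0.
- apply/measurable_EFinP; apply: measurable_funTS.
  exact: measurable_semicircle_pdf.
- by move=> x _; rewrite lee_fin semicircle_pdf_ge0.
Qed.

HB.instance Definition _ := isMeasure.Build _ _ _ (@semicircle R)
  semicircle0 semicircle_ge0 semicircle_sigma_additive.

End semicircle_measure.

(* The Stieltjes transform of the semicircle law in closed form, for x >= 2. *)
Definition Gsigma {R : realType} (x : R) : R := (x - Num.sqrt (x ^+ 2 - 4)) / 2.

Definition Jv {R : realType} (x theta : R) : R :=
  if 2 * theta <= Gsigma x then 2 * theta else x - (2 * theta)^-1.

(* The argument of ln is nonnegative on the support of the semicircle law, and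
   vanishes there at no more than one point. *)
Definition J {R : realType} (x theta : R) : R :=
  theta * Jv x theta -
  2^-1 * \int[semicircle]_y ln (1 + 2 * theta * Jv x theta - 2 * theta * y).

(* The library's convex_function is restricted to real values. The functions
   considered here do not take the value -oo. *)
Definition econvex_function {R : realType} (D : set R) (f : R -> \bar R) :=
  forall t : {i01 R}, {in D &, forall x y : R^o,
    (f (x <| t |> y) <= t%:num%:E * f x + (1 - t%:num)%:E * f y)%E}.

Section law_of_entries.
Context {R : realType}.
Variable mu : probability (measurableTypeR R) R.

Definition symmetric_law :=
  forall A : set R, measurable A -> mu (-%R @^-1` A) = mu A.

(* The log-Laplace transform, +oo where the exponential is not integrable. *)
Definition logLaplace (x : R) : \bar R := lne ('M_mu (@idfun R) x).

Definition psi (x : R) : \bar R := (logLaplace x * ((x ^+ 2)^-1)%:E)%E.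

(* psi is 0 / 0 at the origin, where its limit is 1/2 for a centered law of unit
   variance; leaving this point out does not change the supremum. *)
Definition sup_psi : \bar R := ereal_sup [set psi x | x in [set x | x != 0]].

End law_of_entries.

Definition has_law d (T : measurableType d) (R : realType)
    (P : probability T R) (f : T -> R)
    (mu : probability (measurableTypeR R) R) :=
  measurable_fun setT f /\
  forall A : set R, measurable A -> P (f @^-1` A) = mu A.

(* Mutual independence of the real random variables X i, i in D. *)
Definition independent_family d (T : measurableType d) (R : realType)
    (P : probability T R) (I : finType) (D : {set I}) (X : I -> T -> R) :=
  forall (K : {set I}) (B : I -> set R), K \subset D ->
    (forall i, measurable (B i)) ->
    P (\bigcap_(i in [set` K]) (X i @^-1` B i)) =
    (\prod_(i in K) P (X i @^-1` B i))%E.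

Definition mx_borel {R : realType} m n : set (set 'M[R]_(m, n)) :=
  <<s [set A : set 'M[R]_(m, n) | open A] >>.

Definition measurable_mx d (T : measurableType d) (R : realType) m n
    (X : T -> 'M[R]_(m, n)) :=
  forall A, mx_borel A -> measurable (X @^-1` A).

Definition independent_mx d (T : measurableType d) (R : realType)
    (P : probability T R) m n p q
    (X : T -> 'M[R]_(m, n)) (Y : T -> 'M[R]_(p, q)) :=
  forall A B, mx_borel A -> mx_borel B ->
    P (X @^-1` A `&` Y @^-1` B) = (P (X @^-1` A) * P (Y @^-1` B))%E.

Record wigner_matrix d (T : measurableType d) (R : realType)
    (P : probability T R) (mu : probability (measurableTypeR R) R) N
    (X : T -> 'M[R]_N) : Prop := {
  wigner_measurable : measurable_mx X ;
  wigner_symmetric : forall w, (X w)^T = X w ;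
  wigner_independent : independent_family P
    [set ij : 'I_N * 'I_N | (ij.1 <= ij.2)%N]%SET
    (fun ij w => X w ij.1 ij.2) ;
  wigner_offdiag : forall i j : 'I_N, (i < j)%N ->
    has_law P (fun w => Num.sqrt N%:R * X w i j) mu ;
  wigner_diag : forall i : 'I_N,
    has_law P (fun w => Num.sqrt (N%:R / 2) * X w i i) mu }.

(* The uniform law on the unit sphere is the rotation-invariant probability
   measure on it. *)
Record uniform_on_sphere d (T : measurableType d) (R : realType)
    (P : probability T R) N (e : T -> 'cV[R]_N) : Prop := {
  uniform_measurable : measurable_mx e ;
  uniform_sphere : forall w, \sum_(i < N) e w i ord0 ^+ 2 = 1 ;
  uniform_invariant : forall O : 'M[R]_N, O^T *m O = 1%:M ->
    forall A : set 'cV[R]_N, mx_borel A ->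
    P ((fun w => O *m e w) @^-1` A) = P (e @^-1` A) }.

(* X and e live on one probability space; for independent X and e the
   expectation under P is the iterated one over X and e. *)
Definition annealed d (T : measurableType d) (R : realType)
    (P : probability T R) N (X : T -> 'M[R]_N) (e : T -> 'cV[R]_N)
    (theta : R) : \bar R :=
  ((N%:R^-1)%:E * lne 'E_P[fun w =>
     expR (N%:R * theta * ((e w)^T *m (X w *m e w)) ord0 ord0)])%E.

Definition annealed_limsup (d : nat -> measure_display)
    (T : forall N, measurableType (d N)) (R : realType)
    (P : forall N, probability (T N) R)
    (X : forall N, T N -> 'M[R]_N) (e : forall N, T N -> 'cV[R]_N)
    (theta : R) : \bar R :=
  limn_esup (fun N => annealed (P N) (@X N) (@e N) theta).

Definition Ibar {R : realType} (Fbar : R -> \bar R) (x : R) : \bar R :=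
  ereal_sup [set ((J x theta)%:E - Fbar theta)%E | theta in `[0, +oo[%classic].

(* Main.v *)
(* For z = 2 theta > 0 put
   H(x) = theta (x - 1/z) - 1/2 int ln (z (x - y)) d sigma(y),
   a convex function on [2, +oo[ since ln is concave. The condition
   z <= Gsigma x amounts to z < 1 and x <= z + 1/z, up to the case z = 1, x = 2,
   so that J(x, theta) = H(max(x, z + 1/z)) if z < 1 and J(x, theta) = H(x)
   otherwise. It remains to see that H is nondecreasing beyond z + 1/z: by
   ln (1 + t) <= t, for x <= y,
   H(y) - H(x) >= (y - x) (z - int 1 / (x - .) d sigma) / 2,
   and the Stieltjes transform of sigma at x is Gsigma x <= z. For the last
   identity an explicit primitive of sqrt (4 - y^2) / (x - y) is used. *)

Require Import Defs.
From HB Require Import structures.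
From mathcomp Require Import all_boot all_order all_algebra.
From mathcomp Require Import all_classical all_reals all_analysis.
From mathcomp Require Import measurable_realfun ring lra.

Import Order.TTheory GRing.Theory Num.Def Num.Theory.
Import numFieldNormedType.Exports.

Local Open Scope classical_set_scope.
Local Open Scope ring_scope.

(** * Integration against the image of a measure with density *)

Section integral_density.
Context d d' (T : measurableType d) (T' : measurableType d') (R : realType).
Variables (mu : {measure set T -> \bar R}) (nu : {measure set T' -> \bar R}).
Variables (phi : T -> T') (p : T -> R).
Hypotheses (mphi : measurable_fun setT phi).
Hypotheses (p_ge0 : forall x, 0 <= p x) (mp : measurable_fun setT p).
Hypothesis nuE : forall A, measurable A ->
  nu A = (\int[mu]_(x in phi @^-1` A) (p x)%:E)%E.

Import HBNNSimple.

(** By additivity over the level sets of [h], this reduces to [nuE] on each of them. *)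
Let integral_density_nnsfun (h : {nnsfun T' >-> R}) :
  (\int[nu]_y (h y)%:E = \int[mu]_x ((h (phi x))%:E * (p x)%:E))%E.
Proof.
have hE y : (h y)%:E =
    (\sum_(r \in range h) (r * \1_(h @^-1` [set r]) y)%:E)%E.
  by rewrite fsumEFin// -fimfunE.
under eq_integral do rewrite hE.
under [RHS]eq_integral => x _.
  rewrite hE ge0_mule_fsuml; last by move=> r; exact: nnfun_muleindic_ge0.
  over.
have mindic r : measurable_fun setT (fun y => (r * \1_(h @^-1` [set r]) y)%:E).
  by apply/measurable_EFinP; exact: measurable_funM.
rewrite !ge0_integral_fsum//; first last.
- by move=> r y _; exact: nnfun_muleindic_ge0.
- by move=> r x _; rewrite mule_ge0 ?lee_fin//; exact: nnfun_muleindic_ge0.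
- move=> r; apply: emeasurable_funM; last exact/measurable_EFinP.
  exact: (measurableT_comp (mindic r) mphi).
apply: eq_fsbigr => r /[!inE] -[y _ <-].
have mh : measurable (h @^-1` [set h y]) by [].
rewrite integralZl_indic_nnsfun// integral_indic// setIT nuE//.
have mindic_phi : measurable_fun setT
    (fun x => (\1_(h @^-1` [set h y]) (phi x))%:E : \bar R).
  apply/measurable_EFinP.
  have mI : measurable_fun setT (\1_(h @^-1` [set h y]) : T' -> R).
    exact: measurable_indic.
  exact: (measurableT_comp mI mphi).
under [RHS]eq_integral do rewrite EFinM -muleA.
rewrite ge0_integralZl//; first last.
- by rewrite lee_fin.
- by move=> x _; rewrite mule_ge0 ?lee_fin.
- by apply: emeasurable_funM => //; exact/measurable_EFinP.
congr (_ * _)%E; rewrite integral_mkcond; apply: eq_integral => x _.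
by rewrite epatch_indic muleC.
Qed.

(** Monotone convergence on both sides carries the identity over from simple functions. *)
Lemma ge0_integral_density (f : T' -> \bar R) :
  (forall y, 0 <= f y)%E -> measurable_fun setT f ->
  (\int[nu]_y f y = \int[mu]_x (f (phi x) * (p x)%:E))%E.
Proof.
move=> f0 mf; pose h := nnsfun_approx measurableT mf.
have hf y : (h n y)%:E @[n --> \oo] --> f y by exact: cvg_nnsfun_approx.
have nd_h y : {homo (fun n => (h n y)%:E) : m n / (m <= n)%N >-> (m <= n)%E}.
  by move=> m n mn; rewrite lee_fin; exact/lefP/nd_nnsfun_approx.
transitivity (limn (fun n => \int[nu]_y (h n y)%:E)%E).
  rewrite -monotone_convergence//.
  - by apply: eq_integral => y _; apply/esym/cvg_lim.
  - by move=> n; exact/measurable_EFinP.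
  - by move=> n y _; rewrite lee_fin.
transitivity (limn (fun n => \int[mu]_x ((h n (phi x))%:E * (p x)%:E))%E).
  by congr (limn _); apply/funext => n; exact: integral_density_nnsfun.
rewrite -monotone_convergence//.
- apply: eq_integral => x _; apply/cvg_lim => //.
  by apply: cvgeZr => //; exact: hf.
- move=> n; apply: emeasurable_funM; last exact/measurable_EFinP.
  by apply/measurable_EFinP; exact: measurableT_comp.
- by move=> n x _; rewrite mule_ge0 ?lee_fin.
- by move=> x _ m n mn; rewrite lee_wpmul2r ?lee_fin// -lee_fin; exact: nd_h.
Qed.

(** As [p] is nonnegative, multiplication by it commutes with taking positive and negative parts. *)
Lemma integral_density (f : T' -> \bar R) : measurable_fun setT f ->
  (\int[nu]_y f y = \int[mu]_x (f (phi x) * (p x)%:E))%E.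
Proof.
move=> mf; rewrite integralE [RHS]integralE !ge0_integral_density//.
- by congr (_ - _)%E; apply: eq_integral => x _;
    rewrite ?funeposE ?funenegE/= ?muleN -?mulNe maxe_pMl ?lee_fin ?mul0e.
- exact: measurable_funeneg.
- exact: measurable_funepos.
Qed.

End integral_density.

(** * The arcsine via the half-angle tangent *)

(* On [-1, 1] this is the arcsine, in a form that is differentiable inside the
   interval and visibly continuous up to its endpoints. *)
Definition half_angle_asin {R : realType} (t : R) : R :=
  2 * atan (t / (1 + Num.sqrt (1 - t ^+ 2))).

Section half_angle_asin.
Context {R : realType}.
Implicit Type t : R.

Lemma half_angle_asin1 : half_angle_asin (1 : R) = pi / 2.
Proof.
by rewrite /half_angle_asin expr1n subrr sqrtr0 addr0 divr1 atan1; field.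
Qed.

Lemma half_angle_asinN t : half_angle_asin (- t) = - half_angle_asin t.
Proof. by rewrite /half_angle_asin sqrrN mulNr atanN mulrN. Qed.

Lemma continuous_half_angle_asin : continuous (@half_angle_asin R).
Proof.
move=> t; apply: cvgM; first exact: cvg_cst.
apply: (@continuous_comp _ _ _ (fun t => t / (1 + Num.sqrt (1 - t ^+ 2))) atan).
  apply: cvgM; first exact: cvg_id.
  apply: cvgV; first by rewrite gt_eqF// ltr_pwDl// sqrtr_ge0.
  apply: cvgD; first exact: cvg_cst.
  apply: (@continuous_comp _ _ _ (fun t => 1 - t ^+ 2) Num.sqrt).
    by apply: cvgB; [exact: cvg_cst|exact: exprn_continuous].
  exact: sqrt_continuous.
exact: continuous_atan.
Qed.

Lemma is_derive_half_angle_asin t : -1 < t < 1 ->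
  is_derive t 1 half_angle_asin (Num.sqrt (1 - t ^+ 2))^-1.
Proof.
move=> /andP[t_gtN1 t_lt1].
have t2 : 0 < 1 - t ^+ 2 by nra.
have s0 : 0 < Num.sqrt (1 - t ^+ 2) by rewrite sqrtr_gt0.
have dD : is_derive t 1 (fun t => 1 - t ^+ 2) (- (2 * t)).
  by apply: is_derive_eq; rewrite /GRing.scale/=; ring.
set s := Num.sqrt (1 - t ^+ 2) in s0 *.
have s2 : s ^+ 2 = 1 - t ^+ 2 by rewrite sqr_sqrtr// ltW.
have ds : is_derive t 1 (fun t => Num.sqrt (1 - t ^+ 2)) ((2 * s)^-1 * - (2 * t)).
  have dsqrt := is_derive1_sqrt t2.
  exact: (@is_derive1_comp _ Num.sqrt (fun t => 1 - t ^+ 2)).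
have d0 : 1 + s != 0 by rewrite gt_eqF// ltr_pwDl// ltW.
have d1s : is_derive t 1 (fun t => 1 + Num.sqrt (1 - t ^+ 2)) ((2 * s)^-1 * - (2 * t)).
  by apply: (is_derive_eq (is_deriveD (is_derive_cst _ _ _) ds)); rewrite add0r.
have dV := @is_deriveV _ (fun t => 1 + Num.sqrt (1 - t ^+ 2)) _ _ _ d0 d1s.
have dq := @is_deriveM _ _ id (fun t => (1 + Num.sqrt (1 - t ^+ 2))^-1) t 1 _ _ (is_derive_id _ _) dV.
have da := @is_derive1_comp _ atan _ t _ _ (is_derive1_atan _) dq.
have := @is_deriveZ _ _ _ _ 2 _ _ _ da.
rewrite /GRing.scale/= -/s => dF; apply: (is_derive_eq dF).
have sn0 : s != 0 by rewrite gt_eqF.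
(* Eliminating [t ^+ 2] leaves rational identities in [s]. *)
have t2E : t ^+ 2 = 1 - s ^+ 2 by rewrite s2; ring.
rewrite [X in X ^+ 2](_ : _ = t / (1 + s))//.
have -> : 1 + (t / (1 + s)) ^+ 2 = 2 / (1 + s).
  by rewrite expr_div_n t2E; field.
have -> : t * (- (1 + s) ^- 2 * ((2 * s)^-1 * - (2 * t))) =
    t ^+ 2 * ((1 + s) ^- 2 / s) by field; rewrite sn0 d0.
by rewrite t2E; field; rewrite sn0 d0.
Qed.
End half_angle_asin.

(** * The Stieltjes transform of the semicircle law *)

Section stieltjes_semicircle.
Context {R : realType}.
Implicit Types x y : R.
Local Notation leb := (@lebesgue_measure R).

(* From (4 - y^2) / (x - y) = x + y - (x^2 - 4) / (x - y), after division by
   sqrt (4 - y^2). *)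
Definition stieltjes_primitive x y : R :=
  x * half_angle_asin (y / 2) - Num.sqrt (4 - y ^+ 2)
  - Num.sqrt (x ^+ 2 - 4) * half_angle_asin ((x * y - 4) / (2 * (x - y))).

(** Serves at the endpoints -2 and 2, where the fundamental theorem of calculus asks for continuity
    rather than a derivative. *)
Lemma continuous_stieltjes_primitive x y : y < x ->
  {for y, continuous (stieltjes_primitive x)}.
Proof.
move=> yx; apply: cvgB; first apply: cvgB.
- apply: cvgM; first exact: cvg_cst.
  apply: (@continuous_comp _ _ _ (fun y => y / 2) half_angle_asin).
    by apply: cvgM; [exact: cvg_id|exact: cvg_cst].
  exact: continuous_half_angle_asin.
- apply: (@continuous_comp _ _ _ (fun y => 4 - y ^+ 2) Num.sqrt).
    by apply: cvgB; [exact: cvg_cst|exact: exprn_continuous].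
  exact: sqrt_continuous.
- apply: cvgM; first exact: cvg_cst.
  apply: (@continuous_comp _ _ _ (fun y => (x * y - 4) / (2 * (x - y)))
            half_angle_asin); last exact: continuous_half_angle_asin.
  apply: cvgM.
    apply: cvgB; last exact: cvg_cst.
    by apply: cvgM; [exact: cvg_cst|exact: cvg_id].
  apply: cvgV; first by rewrite mulf_neq0// subr_eq0 gt_eqF.
  apply: cvgM; first exact: cvg_cst.
  by apply: cvgB; [exact: cvg_cst|exact: cvg_id].
Qed.

Lemma is_derive_stieltjes_primitive x y : 2 < x -> -2 < y < 2 ->
  is_derive y 1 (stieltjes_primitive x) (Num.sqrt (4 - y ^+ 2) / (x - y)).
Proof.
move=> x2 /andP[y_gtN2 y_lt2].
have y2 : 0 < 4 - y ^+ 2 by nra.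
have r2 : 0 < x ^+ 2 - 4 by nra.
have xy : 0 < x - y by lra.
have sqrtE (a b : R) : 0 <= b -> b ^+ 2 = a -> Num.sqrt a = b.
  by move=> b0 <-; rewrite sqrtr_sqr ger0_norm.
rewrite /stieltjes_primitive.
set w := fun y => (x * y - 4) / (2 * (x - y)).
set r := Num.sqrt (x ^+ 2 - 4).
have r0 : 0 < r by rewrite sqrtr_gt0.
have rE : r ^+ 2 = x ^+ 2 - 4 by rewrite sqr_sqrtr// ltW.
set s := Num.sqrt (4 - y ^+ 2).
have s0 : 0 < s by rewrite sqrtr_gt0.
have sE : s ^+ 2 = 4 - y ^+ 2 by rewrite sqr_sqrtr// ltW.
have xyn0 : x - y != 0 by rewrite gt_eqF.
have sn0 : s != 0 by rewrite gt_eqF.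
have rn0 : r != 0 by rewrite gt_eqF.
(* Since 4 (x - y)^2 - (x y - 4)^2 = (x^2 - 4) (4 - y^2), the square root in the derivative of the
   second arcsine becomes rational in [r] and [s]. *)
have w2 : 1 - w y ^+ 2 = (r * s / (2 * (x - y))) ^+ 2.
  by rewrite !expr_div_n !exprMn rE sE; field.
have w1 : -1 < w y < 1.
  by rewrite ltr_pdivlMr ?mulr_gt0// ltr_pdivrMr ?mulr_gt0//; nra.
have h1 : -1 < y / 2 < 1 by rewrite ltr_pdivlMr// ltr_pdivrMr//; lra.
have dh : is_derive y 1 (fun y => y / 2) 2^-1.
  by apply: is_derive_eq; rewrite /GRing.scale/=; ring.
have dB1 := @is_derive1_comp _ half_angle_asin _ y _ _
  (is_derive_half_angle_asin _ h1) dh.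
have d4 : is_derive y 1 (fun y => 4 - y ^+ 2) (- (2 * y)).
  by apply: is_derive_eq; rewrite /GRing.scale/=; ring.
have ds := @is_derive1_comp _ Num.sqrt _ y _ _ (is_derive1_sqrt y2) d4.
have dn : is_derive y 1 (fun y => x * y - 4) x.
  by apply: is_derive_eq; rewrite /GRing.scale/=; ring.
have dd : is_derive y 1 (fun y => 2 * (x - y)) (- 2).
  by apply: is_derive_eq; rewrite /GRing.scale/=; ring.
have dn0 : 2 * (x - y) != 0 by rewrite mulf_neq0.
have dw : is_derive y 1 w (r ^+ 2 / (2 * (x - y) ^+ 2)).
  have dV := @is_deriveV _ (fun y => 2 * (x - y)) _ _ _ dn0 dd.
  apply: (is_derive_eq (is_deriveM dn dV)).
  by rewrite rE /GRing.scale/=; field.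
have dB2 := @is_derive1_comp _ half_angle_asin _ y _ _
  (is_derive_half_angle_asin _ w1) dw.
have := is_deriveB (is_deriveB (is_deriveZ x dB1) ds) (is_deriveZ r dB2).
rewrite /GRing.scale/= -/s.
rewrite w2 sqrtr_sqr ger0_norm; last first.
  by rewrite divr_ge0 ?mulr_ge0// ltW.
rewrite (sqrtE (1 - (y / 2) ^+ 2) (s / 2)); first last.
- by rewrite !expr_div_n sE; field.
- by rewrite divr_ge0// ltW.
move=> dF; apply: (is_derive_eq dF).
(* The three terms of the primitive contribute x / s, y / s and - r^2 / ((x - y) s). *)
transitivity ((x + y - r ^+ 2 / (x - y)) / s).
  by field; rewrite ?sn0 ?rn0 ?xyn0.
have -> : s / (x - y) = s ^+ 2 / (x - y) / s.
  by field; rewrite ?sn0 ?rn0 ?xyn0.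
by rewrite rE sE; field; rewrite ?sn0 ?rn0 ?xyn0.
Qed.

Let density_over_continuous x : 2 < x ->
  {within `[-2, 2], continuous (fun y => Num.sqrt (4 - y ^+ 2) / (x - y))}.
Proof.
move=> x2; apply: continuous_in_subspaceT => y; rewrite inE/= in_itv/=.
move=> /andP[_ y2]; apply: cvgM.
  apply: (@continuous_comp _ _ _ (fun y => 4 - y ^+ 2) Num.sqrt).
    by apply: cvgB; [exact: cvg_cst|exact: exprn_continuous].
  exact: sqrt_continuous.
apply: cvgV; first by rewrite subr_eq0 gt_eqF// (le_lt_trans y2).
by apply: cvgB; [exact: cvg_cst|exact: cvg_id].
Qed.

Let semicircle_pdf_divE x : (fun y => semicircle_pdf y / (x - y)) =
  (fun y => (2 * pi)^-1 * (Num.sqrt (4 - y ^+ 2) / (x - y))) \_ `[-2, 2].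
Proof.
apply/funext => y; rewrite patchE /semicircle_pdf indicE.
by case: ifPn => _; rewrite ?mulr1 ?mulr0 ?mul0r// mulrA.
Qed.

Let integrable_div x : 2 < x ->
  leb.-integrable `[-2, 2] (EFin \o (fun y => Num.sqrt (4 - y ^+ 2) / (x - y))).
Proof.
move=> x2; apply: continuous_compact_integrable; first exact: segment_compact.
exact: density_over_continuous.
Qed.

Lemma integrable_semicircle_pdf_div x : 2 < x ->
  leb.-integrable setT (EFin \o (fun y => semicircle_pdf y / (x - y))).
Proof.
move=> x2; rewrite semicircle_pdf_divE -restrict_EFin.
apply/(integrable_mkcond _ _).1 => //.
exact: (integrableZl _ (2 * pi)^-1 (integrable_div _ x2)).
Qed.

(** Both arcsine arguments are 1 at y = 2 and -1 at y = -2, so the primitive grows by pi (x - sqrt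
    (x^2 - 4)), to be divided by 2 pi. *)
Lemma stieltjes_semicircle x : 2 < x ->
  (\int[leb]_y (semicircle_pdf y / (x - y)) = Gsigma x)%R.
Proof.
move=> x2; rewrite semicircle_pdf_divE -Rintegral_mkcond RintegralZl//; last first.
  exact: integrable_div.
rewrite /Rintegral (@continuous_FTC2 _ _ (stieltjes_primitive x))//; first last.
- move=> y; rewrite in_itv/= => y2; rewrite derive1E.
  by have := is_derive_stieltjes_primitive _ _ x2 y2 => dF; rewrite derive_val.
- split.
  + move=> y; rewrite in_itv/= => y2.
    by have [] := is_derive_stieltjes_primitive _ _ x2 y2.
  + apply: cvg_at_right_filter; apply: continuous_stieltjes_primitive; lra.
  + by apply: cvg_at_left_filter; exact: continuous_stieltjes_primitive.
- exact: density_over_continuous.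
- lra.
rewrite -EFinB/= /stieltjes_primitive sqrrN (_ : 4 - 2 ^+ 2 = 0); last by ring.
rewrite sqrtr0 mulNr half_angle_asinN divff// half_angle_asin1.
rewrite (_ : (x * 2 - 4) / _ = 1); last by field; lra.
rewrite (_ : (x * - 2 - 4) / _ = - 1); last by field; lra.
rewrite half_angle_asinN half_angle_asin1 /Gsigma.
have := lt0r_neq0 (pi_gt0 R); move: pi => p p0.
by field.
Qed.

End stieltjes_semicircle.

(** * Values at theta = 0 *)

(** Makes the limsup vanish at theta = 0, which bounds [Ibar] below by 0. *)
Lemma annealed0 d (T : measurableType d) (R : realType) (P : probability T R)
    N (X : T -> 'M[R]_N) (e : T -> 'cV[R]_N) :
  annealed P X e 0 = 0%E.
Proof.
rewrite /annealed (_ : (fun w => _) = cst 1); last first.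
  by apply/funext => w; rewrite mulr0 mul0r expR0.
by rewrite expectation_cst lne1 mule0.
Qed.

Lemma J0 (R : realType) (x : R) : J x 0 = 0.
Proof.
rewrite /J mul0r add0r; under eq_Rintegral.
  by move=> y _; rewrite mulr0 !mul0r addr0 subr0 ln1; over.
by rewrite Rintegral_cst//= mul0r mulr0 oppr0.
Qed.

(** * Logarithmic integrals against the semicircle law *)

Section semicircle_log.
Context {R : realType}.
Implicit Types (c theta x y : R).
Local Notation leb := (@lebesgue_measure R).

(** With the endpoints included, pointwise estimates are left only for -2 < y < 2, where x - y > 0
    even if x = 2. *)
Lemma semicircle_pdf0 y : ~~ (-2 < y < 2) -> semicircle_pdf y = 0.
Proof.
move=> y2; rewrite /semicircle_pdf ler0_sqrtr ?mulr0 ?mul0r//.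
by move: y2; rewrite negb_and -!leNgt => /orP[] ?; nra.
Qed.

Lemma Rintegral_semicircle (f : R -> R) : measurable_fun setT f ->
  (\int[semicircle]_y f y = \int[leb]_y (semicircle_pdf y * f y))%R.
Proof.
move=> mf; rewrite /Rintegral; congr fine.
(* [semicircle] and [leb] live on two copies of R with different displays. *)
pose toR : measurableTypeR R -> R := idfun.
rewrite (@integral_density _ _ _ _ _ leb _ toR semicircle_pdf)//.
- by apply: eq_integral => y _; rewrite -EFinM mulrC.
- by move=> _ A mA; rewrite setTI.
- exact: semicircle_pdf_ge0.
- exact: measurable_semicircle_pdf.
- exact/measurable_EFinP.
Qed.

Lemma measurable_ln_affine c x :
  measurable_fun setT (fun y : R => ln (c * (x - y))).
Proof.
apply: (measurableT_comp (@measurable_ln R)).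
by apply: measurable_funM => //; exact: measurable_funB.
Qed.

(** For s = sqrt x, ln x = 2 ln s, and ln u < u at u = s and u = 1 / s gives |ln s| <= s + 1 / s. *)
Lemma sqrtr_ln_le x : 0 <= x -> Num.sqrt x * `|ln x| <= 2 * (x + 1).
Proof.
rewrite le_eqVlt => /predU1P[<-|x0]; first by rewrite sqrtr0 mul0r; lra.
have s0 : 0 < Num.sqrt x by rewrite sqrtr_gt0.
rewrite -[in ln x](sqr_sqrtr (ltW x0)) -[in leRHS](sqr_sqrtr (ltW x0)).
move: s0; set s := Num.sqrt x => s0.
have lns : `|ln s| <= s + s^-1.
  have := ln_sublinear s0.
  have sV0 : 0 < s^-1 by rewrite invr_gt0.
  have := ln_sublinear sV0; rewrite lnV//.
  by rewrite ler_norml; lra.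
rewrite lnXn// normrMn mulrnAr.
have : s * `|ln s| <= s * (s + s^-1) by rewrite ler_pM2l.
rewrite mulrDr divff ?gt_eqF// -expr2 -mulr_natl; lra.
Qed.

(** The integrand is bounded on [-2, 2]: for x = 2 the square root in the density absorbs the
    logarithmic singularity at y = 2. *)
Lemma integrable_semicircle_ln c x : 0 < c -> 2 <= x ->
  leb.-integrable setT (EFin \o (fun y => semicircle_pdf y * ln (c * (x - y)))).
Proof.
move=> c0 x2; set f := fun y => _.
have mf : measurable_fun setT f.
  apply: measurable_funM; first exact: measurable_semicircle_pdf.
  exact: measurable_ln_affine.
have -> : f = f \_ `[-2, 2].
  apply/funext => y; rewrite patchE; case: ifPn => //.
  rewrite notin_setE/= in_itv/= => /negP y2.
  rewrite /f semicircle_pdf0 ?mul0r//; apply: contra y2.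
  by move=> /andP[/ltW -> /ltW ->].
rewrite -restrict_EFin; apply/(integrable_mkcond _ _).1 => //.
apply: measurable_bounded_integrable => //.
- by apply: compact_finite_measure; exact: segment_compact.
- exact: measurable_funTS.
(* The last factor is the bound of [sqrtr_ln_le] at c (x - y) <= c (x + 2); 1 / sqrt c turns sqrt (c
   (x - y)) back into sqrt (x - y). *)
exists ((2 * pi)^-1 * 2 * (Num.sqrt c)^-1 * (2 * (c * (x + 2) + 1))).
split => [|M /ltW KM y /=]; first exact: num_real.
rewrite in_itv/= => /andP[yN2 y2]; apply: (le_trans _ KM).
have pi2 : 0 <= (2 * pi)^-1 :> R by rewrite invr_ge0 mulr_ge0// pi_ge0.
have xy0 : 0 <= x - y by lra.
have sc0 : 0 < Num.sqrt c by rewrite sqrtr_gt0.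
rewrite /f normrM ger0_norm ?semicircle_pdf_ge0//.
rewrite /semicircle_pdf indicE mem_set/= ?in_itv/= ?yN2// mulr1 -!mulrA.
apply: ler_wpM2l => //.
(* 4 - y^2 = (2 + y) (2 - y) <= 4 (x - y). *)
have s4 : Num.sqrt (4 - y ^+ 2) <= 2 * Num.sqrt (x - y).
  have -> : 2 = Num.sqrt (2 ^+ 2) :> R by rewrite sqrtr_sqr ger0_norm.
  by rewrite -sqrtrM// ler_wsqrtr//; nra.
apply: (@le_trans _ _ (2 * Num.sqrt (x - y) * `|ln (c * (x - y))|)).
  exact: ler_wpM2r.
rewrite -mulrA ler_pM2l// mulrC ler_pdivlMl// mulrC mulrA -sqrtrM; last exact: ltW.
apply: (le_trans (sqrtr_ln_le _ _)); first by rewrite mulr_ge0// ltW.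
by rewrite ler_pM2l// lerD2r ler_pM2l//; lra.
Qed.

(** * Convexity and monotonicity of [Jtail] *)

(* J for v = x - 1 / (2 theta), where 1 + 2 theta v - 2 theta y equals
   2 theta (x - y). *)
Definition Jtail theta x : R :=
  theta * (x - (2 * theta)^-1) -
  2^-1 * \int[leb]_y (semicircle_pdf y * ln (2 * theta * (x - y))).

(** The first term is affine in x; concavity of ln is weighted by the density and integrated. *)
Lemma Jtail_convex theta (t : {i01 R}) x y : 0 < theta -> 2 <= x -> 2 <= y ->
  Jtail theta (t%:num * x + (1 - t%:num) * y) <=
  t%:num * Jtail theta x + (1 - t%:num) * Jtail theta y.
Proof.
move=> th0 x2 y2.
have th20 : 0 < 2 * theta by rewrite mulr_gt0.
have t0 : 0 <= t%:num :> R by [].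
have t1 : 0 <= 1 - t%:num :> R by rewrite subr_ge0.
pose f u v := semicircle_pdf v * ln (2 * theta * (u - v)).
have fi u : 2 <= u -> leb.-integrable setT (EFin \o f u).
  exact: integrable_semicircle_ln.
have w2 : 2 <= t%:num * x + (1 - t%:num) * y by nra.
have Zi (k : R) u : 2 <= u -> leb.-integrable setT (EFin \o (fun v => k * f u v)).
  move=> u2; exact: (integrableZl _ k (fi u u2)).
have : \int[leb]_v (t%:num * f x v + (1 - t%:num) * f y v) <=
    \int[leb]_v f (t%:num * x + (1 - t%:num) * y) v.
  apply: le_Rintegral => //.
  - exact: (integrableD _ (Zi t%:num x x2) (Zi (1 - t%:num) y y2)).
  - exact: fi.
  move=> v _; rewrite /f.
  have [/andP[vN2 v2]|/semicircle_pdf0 ->] := boolP (-2 < v < 2); last first.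
    by rewrite !mul0r !mulr0 addr0.
  have pos u : 2 <= u -> 0 < 2 * theta * (u - v).
    by move=> u2; rewrite mulr_gt0// subr_gt0 (lt_le_trans v2).
  have := concave_ln t (pos _ x2) (pos _ y2).
  rewrite !convRE/= /unstable.onem.
  rewrite (_ : t%:num * (2 * theta * (x - v)) + _ =
    2 * theta * (t%:num * x + (1 - t%:num) * y - v)); last by ring.
  move=> /(ler_wpM2l (semicircle_pdf_ge0 v)); lra.
rewrite RintegralD//; [|exact: Zi|exact: Zi].
rewrite !RintegralZl//; [|exact: fi|exact: fi].
rewrite /Jtail -/(f x) -/(f y) -/(f (t%:num * x + (1 - t%:num) * y)).
lra.
Qed.

Lemma Jtail_le theta x y : 0 < theta -> 2 < x -> x <= y ->
  Gsigma x <= 2 * theta -> Jtail theta x <= Jtail theta y.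
Proof.
move=> th0 x2 xy Gx.
have th20 : 0 < 2 * theta by rewrite mulr_gt0.
pose f u v := semicircle_pdf v * ln (2 * theta * (u - v)).
have fi u : 2 <= u -> leb.-integrable setT (EFin \o f u).
  exact: integrable_semicircle_ln.
have gi := integrable_semicircle_pdf_div _ x2.
have gi' := integrableZl measurableT (y - x) gi.
have y2 : 2 <= y by lra.
have : \int[leb]_v f y v <=
    \int[leb]_v (f x v + (y - x) * (semicircle_pdf v / (x - v))).
  apply: le_Rintegral => //.
  - exact: fi.
  - by apply: (integrableD _ (fi x (ltW x2)) gi').
  move=> v _; rewrite /f.
  have [/andP[vN2 v2]|/semicircle_pdf0 ->] := boolP (-2 < v < 2); last first.
    by rewrite !mul0r mulr0 addr0.
  rewrite mulrCA -mulrDr; apply: ler_wpM2l; first exact: semicircle_pdf_ge0.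
  have xv : 0 < x - v by lra.
  have yv : 0 < y - v by lra.
  rewrite ![ln (_ * (_ - v))]lnM ?posrE// -addrA lerD2l.
  have -> : y - v = (x - v) * (1 + (y - x) / (x - v)).
    by field; rewrite gt_eqF.
  have q0 : 0 <= (y - x) / (x - v) by rewrite divr_ge0 ?(ltW xv)// subr_ge0.
  rewrite lnM ?posrE//; last by rewrite (lt_le_trans ltr01)// lerDl.
  by rewrite lerD2l le_ln1Dx// (lt_le_trans _ q0).
rewrite RintegralD//; last by apply: fi; exact: ltW.
rewrite RintegralZl// stieltjes_semicircle// /Jtail -/(f x) -/(f y).
(* The first term gains theta (y - x), and half the integral gains at most (y - x) Gsigma x / 2 <=
   theta (y - x). *)
nra.
Qed.

(** * Reduction of [J] to [Jtail], and convexity of [J] *)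

(** Covers both branches of [Jv], with z = 2 theta: u = x for v = x - 1 / z, and u = z + 1 / z for v
    = z. *)
Lemma J_Jtail theta x u : 0 < theta -> Jv x theta = u - (2 * theta)^-1 ->
  J x theta = Jtail theta u.
Proof.
move=> th0 vE; rewrite /J vE /Jtail; congr (_ - _ * _).
rewrite -Rintegral_semicircle; last exact: measurable_ln_affine.
apply: eq_Rintegral => y _; congr ln.
by field; rewrite gt_eqF.
Qed.

(** The left side says sqrt (x^2 - 4) <= x - 2 z; if x - 2 z >= 0, squaring gives z x <= z^2 + 1. *)
Lemma le_Gsigma x z : 0 < z -> 2 <= x ->
  (z <= Gsigma x) = (2 * z <= x) && (x <= z + z^-1).
Proof.
move=> z0 x2; rewrite /Gsigma ler_pdivlMr// lerBrDr.
rewrite -lerBrDl [z * 2]mulrC.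
have x4 : 0 <= x ^+ 2 - 4 by nra.
have [zx|xz] := leP (2 * z) x; last first.
  by apply/negbTE; rewrite -ltNge (lt_le_trans _ (sqrtr_ge0 _))// subr_lt0.
rewrite -[x - _]ger0_norm ?subr_ge0// -sqrtr_sqr ler_sqrt ?sqr_ge0//=.
rewrite -[x <= _](ler_pM2l z0) mulrDr divff ?gt_eqF//.
by apply/idP/idP => ?; nra.
Qed.

(** It suffices that (x - 2 z)^2 <= x^2 - 4, which is z^2 + 1 <= z x. *)
Lemma Gsigma_le x z : 0 < z -> z + z^-1 <= x -> Gsigma x <= z.
Proof.
move=> z0 zx; have : z * (z + z^-1) <= z * x by rewrite ler_pM2l.
rewrite mulrDr divff ?gt_eqF// => zx'.
rewrite /Gsigma ler_pdivrMr// lerBlDr -lerBlDl.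
rewrite (le_trans (ler_norm _))// -sqrtr_sqr ler_wsqrtr//; nra.
Qed.

Lemma J_convex theta (t : {i01 R}) x y : 0 <= theta -> 2 <= x -> 2 <= y ->
  J (t%:num * x + (1 - t%:num) * y) theta <=
  t%:num * J x theta + (1 - t%:num) * J y theta.
Proof.
rewrite le_eqVlt => /predU1P[<- _ _|th0 x2 y2].
  by rewrite !J0 !mulr0 addr0.
set z := 2 * theta.
have z0 : 0 < z by rewrite mulr_gt0.
have t0 : 0 <= t%:num :> R by [].
have t1 : 0 <= 1 - t%:num :> R by rewrite subr_ge0.
set w := t%:num * x + (1 - t%:num) * y.
have w2 : 2 <= w by rewrite /w; nra.
have [z1|z1] := leP 1 z.
  have JE u : 2 <= u -> J u theta = Jtail theta u.
    move=> u2; apply: J_Jtail => //; rewrite /Jv -/z; case: ifPn => //.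
    rewrite le_Gsigma// => /andP[zu uz].
    have : z * u <= z * (z + z^-1) by rewrite ler_pM2l.
    rewrite mulrDr divff ?gt_eqF// => zu'.
    (* 2 z <= u and z u <= z^2 + 1 force z <= 1, hence z = 1 and u = 2, where the two branches of
       [Jv] agree. *)
    have zE : z = 1 by nra.
    by rewrite zE invr1; nra.
  by rewrite !JE//; exact: Jtail_convex.
set a := z + z^-1.
(* Strict because z < 1; the Stieltjes formula behind [Jtail_le] is available only beyond 2. *)
have a2 : 2 < a.
  rewrite -(ltr_pM2l z0) [ltRHS]mulrDr divff ?gt_eqF//; nra.
have JE u : 2 <= u -> J u theta = Jtail theta (Num.max u a).
  move=> u2; apply: J_Jtail => //; rewrite /Jv -/z le_Gsigma//.
  have -> /= : 2 * z <= u by lra.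
  by case: leP => ua; rewrite /a ?addrK//; ring.
have max2 u : 2 <= Num.max u a by rewrite le_max (ltW a2) orbT.
rewrite !JE//.
(* u |-> max(u, a) is convex and [Jtail] is convex and nondecreasing beyond a, so their composition
   is convex. *)
apply: (le_trans _ (Jtail_convex theta t _ _ th0 (max2 x) (max2 y))).
apply: Jtail_le => //; first by rewrite lt_max a2 orbT.
- rewrite ge_max; apply/andP; split.
    by apply: lerD; apply: ler_wpM2l => //; rewrite le_max lexx.
  have xa : a <= Num.max x a by rewrite le_max lexx orbT.
  have ya : a <= Num.max y a by rewrite le_max lexx orbT.
  by have := ler_wpM2l t0 xa; have := ler_wpM2l t1 ya; lra.
- by apply: Gsigma_le => //; rewrite le_max lexx orbT.
Qed.

End semicircle_log.

(** * Convexity of the supremum over theta *)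

Lemma Ibar_econvex (R : realType) (F : R -> \bar R) (D : set R) :
  F 0 = 0%E ->
  (forall theta : R, 0 <= theta -> convex_function (E := R^o) D (J^~ theta)) ->
  econvex_function D (Ibar F).
Proof.
move=> F0 Jconvex t x y xD yD.
have Ibar_ge u (theta : R) : 0 <= theta -> ((J u theta)%:E - F theta <= Ibar F u)%E.
  by move=> th0; apply: ereal_sup_ubound; exists theta; rewrite //= in_itv/= th0.
(* theta = 0 keeps Ibar above 0, so that no oo - oo occurs on the
   right. *)
have Ibar_ge0 u : (0 <= Ibar F u)%E.
  by rewrite (le_trans _ (Ibar_ge u 0 _))// J0 F0 sube0.
have t0 : 0 <= t%:num :> R by [].
have t1 : 0 <= 1 - t%:num :> R by rewrite subr_ge0.
apply: ge_ereal_sup => z [theta /=]; rewrite in_itv/= andbT => th0 zE; rewrite -{z}zE.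
have := Ibar_ge x _ th0; have := Ibar_ge y _ th0.
(* For finite [F theta], convexity of [J] minus a constant suffices; for +oo the left side is
   -oo. *)
case: (F theta) => [r| |].
- move=> Iy Ix; apply: le_trans (leeD (lee_wpmul2l _ Ix) (lee_wpmul2l _ Iy));
    rewrite ?lee_fin//.
  have /= := Jconvex _ th0 t _ _ xD yD.
  rewrite !convRE/= /unstable.onem; lra.
- by move=> _ _; exact: leNye.
(* [F theta] = -oo makes [Ibar] equal to +oo at x and y. Since 0 * +oo = 0, the infinite term on the
   right is the first if t > 0 and the second if t = 0. *)
- rewrite /= !leye_eq => /eqP -> /eqP ->.
  case: (ltgtP 0 (t%:num : R)) t0 => // [t_gt0|<-] _.
    by rewrite gt0_muley ?lte_fin// addye ?leey// gt_eqF// (lt_le_trans ltNy0)//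
      mule_ge0// ?leey// lee_fin.
  by rewrite mul0e add0e subr0 mul1e.
Qed.

Theorem proposition3 (R : realType) :
  (forall theta : R, 0 <= theta ->
    convex_function (E := R^o) `[2, +oo[%classic (J^~ theta)) /\
  (forall (mu : probability (measurableTypeR R) R) (B : R)
      (d : nat -> measure_display) (T : forall N, measurableType (d N))
      (P : forall N, probability (T N) R)
      (X : forall N, T N -> 'M[R]_N) (e : forall N, T N -> 'cV[R]_N),
    symmetric_law mu ->
    'V_mu[@idfun R]%E = 1%E ->
    (1 < 2%:E * sup_psi mu < +oo)%E ->
    (2%:E * psi mu x)%E @[x --> +oo] --> B%:E ->
    (2%:E * psi mu x)%E @[x --> -oo] --> B%:E ->
    0 <= B ->
    [lipschitz fine (logLaplace mu (Num.sqrt x)) | x in `[0, +oo[%classic] ->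
    (forall N, (0 < N)%N -> wigner_matrix (P N) mu (X N)) ->
    (forall N, (0 < N)%N -> uniform_on_sphere (P N) (e N)) ->
    (forall N, (0 < N)%N -> independent_mx (P N) (X N) (e N)) ->
    econvex_function `[2, +oo[%classic (Ibar (annealed_limsup P X e))).
Proof.
have Jconvex (theta : R) : 0 <= theta ->
    convex_function (E := R^o) `[2, +oo[%classic (J^~ theta).
  move=> th0 t x y; rewrite !inE/= !in_itv/= !andbT => x2 y2.
  exact: J_convex.
split=> // mu B d T P X e _ _ _ _ _ _ _ _ _ _.
apply: Ibar_econvex => //; rewrite /annealed_limsup.
(* The hypothesis on [F 0]: at theta = 0 the sequence is constantly 0, hence so is its limsup. *)
rewrite (_ : (fun N => _) = cst 0%E); last first.
  by apply/funext => N; exact: annealed0.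
by have [_ ->] := cvg_limn_einf_sup (cvg_cst (0%E : \bar R)).
Qed.
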